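(* Let $\alpha\in(0,1]$, let $A\in\mathbb{R}^{d\times n}$ have columns $a_1,\dots,a_n$, let $f:\mathbb{R}^d\to\mathbb{R}$ be a closed convex function, and let $L_E=\{x\in\mathbb{R}^n:\alpha\|x\|_1+\frac{1-\alpha}{2}\|x\|_2^2\le1\}$. Consider $\min_{x\in L_E}f(Ax)$ and let $(x^\star,w^\star)$ be an optimal primal-dual pair. Then for every $i\in\{1,\dots,n\}$, $$|a_i^\top w^\star|+(Ax^\star)^\top w^\star\left[\frac{\alpha}{1+\frac{1-\alpha}{2}\|x^\star\|_2^2}\right]<0\ \Longrightarrow\ x_i^\star=0 .$$
   Context: The constrained problem $\min_{x\in\mathcal{C}}f(Ax)$ is viewed as $\min_x f(Ax)+g(x)$ with $g=\iota_{\mathcal{C}}$ the indicator function of $\mathcal{C}$ ($0$ on $\mathcal{C}$, $+\infty$ outside); its dual is $\min_{w\in\mathbb{R}^d} f^*(w)+g^*(-A^\top w)$, where $h^*(v)=\sup_u v^\top u-h(u)$. An optimal primal-dual pair $(x^\star,w^\star)$ is a pair satisfying the first-order optimality conditions $w^\star\in\partial f(Ax^\star)$, $Ax^\star\in\partial f^*(w^\star)$, $-A^\top w^\star\in\partial g(x^\star)$, $x^\star\in\partial g^*(-A^\top w^\star)$. *)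

(* Defs.v *)
From HB Require Import structures.
From mathcomp Require Import all_boot all_order all_algebra.
From mathcomp Require Import all_classical all_reals all_analysis.

Set Implicit Arguments.
Unset Strict Implicit.
Unset Printing Implicit Defensive.

Import Order.TTheory GRing.Theory Num.Theory.
Import numFieldNormedType.Exports.

Local Open Scope classical_set_scope.
Local Open Scope ring_scope.

Section convex_duality.
Context {R : realType}.

Definition dotp (n : nat) (u v : 'cV[R]_n) : R := (u^T *m v) 0 0.

Definition norm1 (n : nat) (x : 'cV[R]_n) : R := \sum_(i < n) `|x i 0|.

Definition norm2 (n : nat) (x : 'cV[R]_n) : R :=
  Num.sqrt (\sum_(i < n) x i 0 ^+ 2).

Definition closed_function (n : nat) (f : 'cV[R]_n -> R) : Prop :=
  closed [set p : 'cV[R]_n * R | f p.1 <= p.2].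

(* No indeterminate difference occurs: the first term is always finite. *)
Definition conjugate (n : nat) (h : 'cV[R]_n -> \bar R) (v : 'cV[R]_n) : \bar R :=
  ereal_sup [set ((dotp v u)%:E - h u)%E | u in [set: 'cV[R]_n]].

(* As usual, the subdifferential is empty where h is infinite. *)
Definition subdifferential (n : nat) (h : 'cV[R]_n -> \bar R) (x : 'cV[R]_n) :
    set 'cV[R]_n :=
  [set v | h x \is a fin_num /\
           forall y, (h x + (dotp v (y - x))%:E <= h y)%E].

(* The convex-analytic indicator, not the 0/1-valued \1_C. *)
Definition indicator (n : nat) (C : set 'cV[R]_n) (x : 'cV[R]_n) : \bar R :=
  if x \in C then 0%E else +oo%E.

(* First-order optimality conditions for the primal problem
   min_x f (A x) + g x and its dual min_w f^* w + g^* (- A^T w). *)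
Definition optimal_primal_dual_pair (d n : nat) (A : 'M[R]_(d, n))
    (f : 'cV[R]_d -> \bar R) (g : 'cV[R]_n -> \bar R)
    (x : 'cV[R]_n) (w : 'cV[R]_d) : Prop :=
  [/\ subdifferential f (A *m x) w,
      subdifferential (conjugate f) w (A *m x),
      subdifferential g x (- (A^T *m w)) &
      subdifferential (conjugate g) (- (A^T *m w)) x].

Definition elastic_net_ball (n : nat) (alpha : R) : set 'cV[R]_n :=
  [set x | alpha * norm1 x + (1 - alpha) / 2 * norm2 x ^+ 2 <= 1].

End convex_duality.

(* Main.v *)
(* Optimality says that x maximises <v, .> over the elastic net ball, where
   v = - A^T w.  If x_i were nonzero, shrink the i-th coordinate by a factor of
   order 1 - t and rescale x by 1 + t s.  To first order in t this stays in the
   ball as soon as s (1 + q) < alpha |x_i|, with q = (1 - alpha)/2 ||x||_2^2,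
   because the radial derivative alpha ||x||_1 + 2 q of the constraint is at
   most 1 + q.  Maximality then gives s <v, x> <= v_i x_i for all such s, hence
   alpha <v, x> / (1 + q) <= |v_i|. *)
Require Import Defs.
From HB Require Import structures.
From mathcomp Require Import all_boot all_order all_algebra.
From mathcomp Require Import all_classical all_reals all_analysis.
From mathcomp Require Import ring lra.

Set Implicit Arguments.
Unset Strict Implicit.
Unset Printing Implicit Defensive.

Import Order.TTheory GRing.Theory Num.Theory.
Import numFieldNormedType.Exports.

Local Open Scope classical_set_scope.
Local Open Scope ring_scope.

Section shrink_coordinate.
Context {R : realType} {n : nat}.
Implicit Types (x v : 'cV[R]_n) (i : 'I_n).

(** Subtracting [t] from the factor at [i], instead of multiplying by [1 - t], makes [dotp] and, for
    [0 <= t <= c], [norm1] affine in [c] and [t]. *)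
Definition scale_shrink x i (c t : R) : 'cV[R]_n :=
  \col_j ((c - t *+ (j == i)) * x j 0).

Lemma dotpE (u v : 'cV[R]_n) : dotp u v = \sum_j u j 0 * v j 0.
Proof. by rewrite /dotp mxE; apply: eq_bigr => j _; rewrite mxE. Qed.

Lemma norm2_sqr x : norm2 x ^+ 2 = \sum_j x j 0 ^+ 2.
Proof. by rewrite sqr_sqrtr// sumr_ge0// => j _; exact: sqr_ge0. Qed.

Lemma sum_only (F : 'I_n -> R) i : \sum_j F j *+ (j == i) = F i.
Proof.
by rewrite (bigD1 i)//= eqxx big1 ?addr0// => j /negPf ->.
Qed.

Lemma dotp_scale_shrink v x i c t :
  dotp v (scale_shrink x i c t) = c * dotp v x - t * (v i 0 * x i 0).
Proof.
rewrite !dotpE mulr_sumr -(sum_only (fun j => t * (v j 0 * x j 0)) i) -sumrB.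
apply: eq_bigr => j _; rewrite mxE.
by case: (j == i); rewrite ?mulr1n ?mulr0n; ring.
Qed.

Lemma norm1_scale_shrink x i c t : 0 <= t -> t <= c ->
  norm1 (scale_shrink x i c t) = c * norm1 x - t * `|x i 0|.
Proof.
move=> t0 tc; rewrite /norm1 mulr_sumr -(sum_only (fun j => t * `|x j 0|) i).
rewrite -sumrB; apply: eq_bigr => j _; rewrite mxE normrM.
by case: (j == i); rewrite ?mulr1n ?mulr0n ger0_norm; first [lra | ring].
Qed.

(** The gain from shrinking coordinate [i] is second-class here and dropped: the [norm1] term alone
    pays for the rescaling. *)
Lemma norm2_scale_shrink_le x i c t : 0 <= t -> t <= c ->
  norm2 (scale_shrink x i c t) ^+ 2 <= c ^+ 2 * norm2 x ^+ 2.
Proof.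
move=> t0 tc; rewrite !norm2_sqr mulr_sumr; apply: ler_sum => j _.
rewrite mxE exprMn ler_wpM2r ?sqr_ge0// ler_sqr ?nnegrE.
all: by case: (j == i); rewrite ?mulr1n ?mulr0n; lra.
Qed.

(** With [c = 1 + t * s], multiplying the constraint at [x] by [c] bounds the new value by
    [c + c * (c - 1) * q - t * alpha * |x_i|], which is [1 + t * (s * (1 + q) + t * s ^+ 2 * q -
    alpha * |x_i|)]. *)
Lemma elastic_net_ball_scale_shrink alpha x i s t :
  0 <= alpha -> alpha <= 1 -> 0 <= s -> 0 <= t -> t <= 1 ->
  elastic_net_ball alpha x ->
  let q := (1 - alpha) / 2 * norm2 x ^+ 2 in
  s * (1 + q) + t * (s ^+ 2 * q) <= alpha * `|x i 0| ->
  elastic_net_ball alpha (scale_shrink x i (1 + t * s) t).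
Proof.
move=> a0 a1 s0 t0 t1; rewrite /elastic_net_ball/= => xball hs.
have ts0 : 0 <= t * s by exact: mulr_ge0.
have tc : t <= 1 + t * s by lra.
rewrite norm1_scale_shrink//.
have b0 : 0 <= (1 - alpha) / 2 by lra.
have := ler_wpM2l b0 (norm2_scale_shrink_le x i t0 tc).
have c0 : 0 <= 1 + t * s by lra.
have := ler_wpM2l c0 xball; have := ler_wpM2l t0 hs.
lra.
Qed.

Lemma elastic_net_support_zero alpha x v i :
  0 < alpha -> alpha <= 1 -> elastic_net_ball alpha x ->
  (forall y, elastic_net_ball alpha y -> dotp v y <= dotp v x) ->
  `|v i 0| < dotp v x * (alpha / (1 + (1 - alpha) / 2 * norm2 x ^+ 2)) ->
  x i 0 = 0.
Proof.
move=> a0 a1 xball vmax.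
set q := (1 - alpha) / 2 * norm2 x ^+ 2 => hv.
have q0 : 0 <= q by rewrite mulr_ge0 ?sqr_ge0//; lra.
set k := alpha / (1 + q) in hv.
have k0 : 0 < k by rewrite divr_gt0//; lra.
have kq : k * (1 + q) = alpha by rewrite mulfVK//; lra.
set l := dotp v x in hv vmax.
have l0 : 0 < l by rewrite -(pmulr_lgt0 _ k0); exact: le_lt_trans hv.
apply/eqP; apply: contraT; rewrite -normr_gt0 => xi0.
(* The midpoint of [|v_i| / l] and [k]: below [k] it leaves room in the constraint, above
   [|v_i| / l] it makes the objective increase. *)
pose m := (`|v i 0| / l + k) / 2.
have hm : `|v i 0| / l < k by rewrite ltr_pdivrMr// mulrC.
have vl0 : 0 <= `|v i 0| / l by rewrite divr_ge0 // ltW.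
have m0 : 0 < m by rewrite /m; lra.
have mk : m < k by rewrite /m; lra.
have vm : `|v i 0| < m * l by rewrite -ltr_pdivrMr// /m; lra.
pose s := m * `|x i 0|.
have s0 : 0 < s by exact: mulr_gt0.
(* First-order slack in the constraint, positive because [m < k]. *)
pose g := alpha * `|x i 0| - s * (1 + q).
have g0 : 0 < g.
  by rewrite /g -kq /s subr_gt0 mulrAC ltr_pM2r// ltr_pM2r//; lra.
pose r := s ^+ 2 * q.
have r0 : 0 <= r by rewrite mulr_ge0 ?sqr_ge0.
(* This step lies in [(0, 1]] and keeps the second-order term [t * r] within the slack, even when
   [r = 0]. *)
pose t := g / (g + r).
have t0 : 0 < t by rewrite divr_gt0//; lra.
have t1 : t <= 1 by rewrite ler_pdivrMr; lra.
have trg : t * r <= g.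
  have E : t * (g + r) = g by rewrite mulfVK//; lra.
  by have := mulr_ge0 (ltW t0) (ltW g0); lra.
have /vmax : elastic_net_ball alpha (scale_shrink x i (1 + t * s) t).
  apply: elastic_net_ball_scale_shrink; rewrite -/q -/r ?(ltW a0) ?(ltW s0) //.
    exact: ltW.
  by move: trg; rewrite /g; lra.
rewrite dotp_scale_shrink -/l => ub.
(* Cancelling [t] leaves [s * l <= v_i * x_i], against [|v_i| < m * l]. *)
have : t * (s * l) <= t * (v i 0 * x i 0) by lra.
rewrite ler_pM2l// leNgt => /negP[].
by rewrite (le_lt_trans (ler_norm _))// normrM /s mulrAC ltr_pM2r//.
Qed.

End shrink_coordinate.

Lemma dotp_mulmxl (R : realType) (d n : nat) (A : 'M[R]_(d, n)) x w :
  dotp (A *m x) w = dotp x (A^T *m w).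
Proof. by rewrite /dotp trmx_mul mulmxA. Qed.

Lemma dotp_col (R : realType) (d n : nat) (A : 'M[R]_(d, n)) w i :
  dotp (col i A) w = (A^T *m w) i 0.
Proof. by rewrite dotpE mxE; apply: eq_bigr => j _; rewrite !mxE. Qed.

Lemma dotpC (R : realType) (n : nat) (u v : 'cV[R]_n) : dotp u v = dotp v u.
Proof. by rewrite !dotpE; apply: eq_bigr => j _; rewrite mulrC. Qed.

Lemma dotpNl (R : realType) (n : nat) (u v : 'cV[R]_n) :
  dotp (- u) v = - dotp u v.
Proof. by rewrite /dotp linearN mulNmx mxE. Qed.

Lemma dotpBr (R : realType) (n : nat) (u v w : 'cV[R]_n) :
  dotp u (v - w) = dotp u v - dotp u w.
Proof. by rewrite /dotp mulmxBr !mxE. Qed.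

(** Subgradients of an indicator are normal vectors to [C]; the finiteness clause of
    [subdifferential] forces [x] into [C]. *)
Lemma subdifferential_indicator (R : realType) (n : nat)
    (C : set 'cV[R]_n) x v :
  subdifferential (indicator C) x v ->
  C x /\ forall y, C y -> dotp v y <= dotp v x.
Proof.
rewrite /subdifferential /indicator /=; case: ifPn => [/set_mem Cx|_ [] //].
move=> [_ h]; split => // y Cy; have := h y.
by rewrite mem_set// add0e lee_fin dotpBr subr_le0.
Qed.

Theorem theorem12 (R : realType) (d n : nat) (alpha : R)
    (A : 'M[R]_(d, n)) (f : 'cV[R]_d -> R)
    (xs : 'cV[R]_n) (ws : 'cV[R]_d)
    (alpha_gt0 : 0 < alpha) (alpha_le1 : alpha <= 1)
    (f_closed : closed_function f)
    (f_convex : @convex_function R 'cV[R]_d setT f)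
    (opt : optimal_primal_dual_pair A (fun u => (f u)%:E)
             (indicator (elastic_net_ball alpha)) xs ws) :
  forall i : 'I_n,
    `|dotp (col i A) ws| +
      dotp (A *m xs) ws *
        (alpha / (1 + (1 - alpha) / 2 * norm2 xs ^+ 2)) < 0 ->
    xs i 0 = 0.
Proof.
move=> i hi; case: opt => _ _ /subdifferential_indicator[xball vmax] _.
apply: (elastic_net_support_zero alpha_gt0 alpha_le1 xball vmax).
(* For [v = - A^T w], [<v, x> = - (A x)^T w] and [|v_i| = |a_i^T w|]. *)
move: hi; rewrite dotp_mulmxl dotp_col dotpC dotpNl mulNr.
have -> : (- (A^T *m ws)) i 0 = - (A^T *m ws) i 0 by rewrite mxE.
by rewrite normrN; lra.
Qed.
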